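(* Let $\Sigma$ be a compact spacelike surface in $\mathbb{L}^3$ with (necessarily) non-empty boundary $\partial\Sigma$ such that $H_R=H_L$ on $\Sigma$. Then $\Sigma$ is contained in the convex hull of $\partial\Sigma$.
   Context: $\mathbb{L}^3$ is $\mathbb{R}^3$ endowed with the metric $\langle\cdot,\cdot\rangle_L=dx_1^2+dx_2^2-dx_3^2$; $\langle\cdot,\cdot\rangle_R$ is the Euclidean metric of $\mathbb{R}^3$. The Levi-Civita connections of both metrics coincide and are denoted by $\overline\nabla$. A smooth connected surface $\Sigma\subset\mathbb{R}^3$ is spacelike if the metric induced on it by $\langle\cdot,\cdot\rangle_L$ is Riemannian. There are no compact spacelike surfaces without boundary in $\mathbb{L}^3$. Let $N_L$ be the future-directed (positive third component) unit normal field of $\Sigma$ with respect to $\langle\cdot,\cdot\rangle_L$ (so $\langle N_L,N_L\rangle_L=-1$), and $N_R$ the upwards-directed unit normal field with respect to $\langle\cdot,\cdot\rangle_R$. The shape operators are $A_LX=-\overline\nabla_XN_L$ and $A_RX=-\overline\nabla_XN_R$, and the mean curvatures are $H_L=-\frac12\mathrm{tr}\,A_L$ and $H_R=\frac12\mathrm{tr}\,A_R$. Where $\Sigma$ is the graph of a smooth function $u$ with $|Du|<1$ over a domain of the plane $x_3=0$, $H_L=\frac12\mathrm{div}\big(Du/\sqrt{1-|Du|^2}\big)$ and $H_R=\frac12\mathrm{div}\big(Du/\sqrt{1+|Du|^2}\big)$. Convex hulls are taken in the affine space $\mathbb{R}^3$. *)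

(* Defs.v *)
From HB Require Import structures.
From mathcomp Require Import all_boot all_order all_algebra.
From mathcomp Require Import all_classical all_reals all_analysis.
Set Implicit Arguments.
Unset Strict Implicit.
Unset Printing Implicit Defensive.
Import Order.TTheory GRing.Theory Num.Theory.
Import numFieldNormedType.Exports.
Local Open Scope classical_set_scope.
Local Open Scope ring_scope.

(* Points and vectors of R^3 are row vectors; the coordinates x_1, x_2, x_3 of
   x are x 0 0, x 0 1, x 0 2. *)

Definition lorentz {R : realType} (u v : 'rV[R]_3) : R :=
  u 0 0 * v 0 0 + u 0 1 * v 0 1 - u 0 2 * v 0 2.

Definition euclid {R : realType} (u v : 'rV[R]_3) : R :=
  u 0 0 * v 0 0 + u 0 1 * v 0 1 + u 0 2 * v 0 2.

(* f is of class C^n on the open set U; in finite dimension x |-> 'd f x is of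
   class C^n iff every directional derivative 'D_v f is. *)
Fixpoint class_C {R : realType} (n : nat) (U : set 'rV[R]_3)
    (f : 'rV[R]_3 -> 'rV[R]_3) : Prop :=
  match n with
  | 0%N => forall x, U x -> {for x, continuous f}
  | m.+1 => (forall x, U x -> differentiable f x) /\
            (forall v, class_C m U ('D_v f))
  end.

Definition smooth_on {R : realType} (U : set 'rV[R]_3)
    (f : 'rV[R]_3 -> 'rV[R]_3) : Prop := forall n, class_C n U f.

Definition plane {R : realType} : set 'rV[R]_3 := [set x | x 0 2 = 0].

Definition half_plane {R : realType} : set 'rV[R]_3 :=
  [set x | x 0 2 = 0 /\ 0 <= x 0 0].

(* phi is a smooth diffeomorphism from the open neighbourhood U of p onto the
   open set W, with inverse psi, which carries the part of S in U onto the part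
   of the model M in W. *)
Definition chart_at {R : realType} (M S : set 'rV[R]_3) (p : 'rV[R]_3)
    (U W : set 'rV[R]_3) (phi psi : 'rV[R]_3 -> 'rV[R]_3) : Prop :=
  [/\ open U /\ U p, open W, smooth_on U phi, smooth_on W psi &
      [/\ forall x, U x -> W (phi x) /\ psi (phi x) = x,
          forall y, W y -> U (psi y) /\ phi (psi y) = y &
          phi @` (S `&` U) = M `&` W]].

(* Embedded smooth surfaces of R^3, possibly with boundary. *)
Definition smooth_surface {R : realType} (S : set 'rV[R]_3) : Prop :=
  forall p, S p -> exists U W phi psi,
    chart_at plane S p U W phi psi \/ chart_at half_plane S p U W phi psi.

Definition surface_interior {R : realType} (S : set 'rV[R]_3)
    : set 'rV[R]_3 :=
  [set p | S p /\ exists U W phi psi, chart_at plane S p U W phi psi].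

Definition surface_boundary {R : realType} (S : set 'rV[R]_3)
    : set 'rV[R]_3 := S `\` surface_interior S.

(* At boundary points too this is the whole tangent plane, not a half-plane. *)
Definition tangent {R : realType} (S : set 'rV[R]_3) (p : 'rV[R]_3)
    : set 'rV[R]_3 :=
  [set v | exists U W phi psi,
    (chart_at plane S p U W phi psi \/ chart_at half_plane S p U W phi psi) /\
    plane ('d phi p v)].

Definition spacelike {R : realType} (S : set 'rV[R]_3) : Prop :=
  forall p v, S p -> tangent S p v -> v != 0 -> 0 < lorentz v v.

Definition upward_unit_normal {R : realType} (g : 'rV[R]_3 -> 'rV[R]_3 -> R)
    (eps : R) (S : set 'rV[R]_3) (p : 'rV[R]_3) : 'rV[R]_3 :=
  get [set n | [/\ forall v, tangent S p v -> g n v = 0,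
                   g n n = eps & 0 < n 0 2]].

Definition N_L {R : realType} : set 'rV[R]_3 -> 'rV[R]_3 -> 'rV[R]_3 :=
  upward_unit_normal lorentz (-1).

Definition N_R {R : realType} : set 'rV[R]_3 -> 'rV[R]_3 -> 'rV[R]_3 :=
  upward_unit_normal euclid 1.

(* The covariant derivative at p, in the direction v tangent to S, of a vector
   field Y along S: only the values of Y on S are meaningful, so Y is replaced
   by any local extension Z that is differentiable at p. The common Levi-Civita
   connection of both flat metrics is the usual directional derivative. *)
Definition nabla {R : realType} (S : set 'rV[R]_3)
    (Y : 'rV[R]_3 -> 'rV[R]_3) (p v : 'rV[R]_3) : 'rV[R]_3 :=
  get [set w | exists Z : 'rV[R]_3 -> 'rV[R]_3,
    [/\ \forall q \near p, S q -> Z q = Y q, differentiable Z p &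
        w = 'd Z p v]].

Definition A_L {R : realType} (S : set 'rV[R]_3) (p X : 'rV[R]_3)
    : 'rV[R]_3 := - nabla S (N_L S) p X.

Definition A_R {R : realType} (S : set 'rV[R]_3) (p X : 'rV[R]_3)
    : 'rV[R]_3 := - nabla S (N_R S) p X.

(* The trace of an endomorphism f of the two-dimensional subspace T: the rows
   of B are a basis of T, in which f has (row-vector) matrix M. *)
Definition trace_on {R : realType} (T : set 'rV[R]_3)
    (f : 'rV[R]_3 -> 'rV[R]_3) : R :=
  get [set t | exists (B : 'M[R]_(2, 3)) (M : 'M[R]_2),
    [/\ row_free B, forall v : 'rV[R]_3, T v <-> (v <= B)%MS,
        forall i, f (row i B) = row i M *m B & t = \tr M]].

Definition H_L {R : realType} (S : set 'rV[R]_3) (p : 'rV[R]_3) : R :=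
  - (2^-1 * trace_on (tangent S p) (A_L S p)).

Definition H_R {R : realType} (S : set 'rV[R]_3) (p : 'rV[R]_3) : R :=
  2^-1 * trace_on (tangent S p) (A_R S p).

Definition convex_hull {R : realType} (A : set 'rV[R]_3) : set 'rV[R]_3 :=
  smallest (fun C : set (convex_lmodType 'rV[R]_3) => convex_set C) A.

(* Main.v *)
Require Import Defs.
From HB Require Import structures.
From mathcomp Require Import all_boot all_order all_algebra.
From mathcomp Require Import all_classical all_reals all_analysis.
From mathcomp Require Import ring lra.
Set Implicit Arguments.
Unset Strict Implicit.
Unset Printing Implicit Defensive.
Import Order.TTheory GRing.Theory Num.Theory.
Import numFieldNormedType.Exports.
Local Open Scope classical_set_scope.
Local Open Scope ring_scope.

(** The idea is to touch the surface with a level set of a strictly convex function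
    and to contradict the ellipticity of the equation H_R = H_L.

    Locally an interior part of the surface is the zero set of the third coordinate
    F of a chart. Let n be the gradient of F, let A be its derivative, and put
    m = n_0^2 + n_1^2. Each mean curvature is, up to sign, half the divergence of the
    unit normal extended by normalising n, and if m is not zero both are equal,
    up to the same nonzero factor, to
      (a + b / D) / sqrt D,   a = A(v1, v1),  b = A(v2, v2),
    for the same two tangent vectors v1, v2; only D = n_2^2 + m (Euclidean) or
    D = n_2^2 - m (Lorentzian) depends on the metric ([normalize_trace]). Since the
    two values of D differ, H_R = H_L excludes that a and b are nonzero of the same
    sign: the second fundamental form is not definite wherever the tangent plane is
    not horizontal ([no_definite_curvature]). If m = 0 the equation is void, and
    horizontal tangent planes have to be avoided.

    Suppose now that a point p of the surface is not in the convex hull of the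
    boundary. The boundary is compact, hence so is its hull, by Caratheodory's
    theorem, and a linear functional separates p strictly from the boundary
    ([strict_separation]). It may be tilted so as not to be vertical and made
    strictly convex by adding eps * |x|^2, still larger at p than on the boundary
    and with a gradient that is vertical nowhere on the surface
    ([separating_paraboloid]). Its maximum over the surface is then attained at an
    interior point q. There the gradient is normal to the surface, so the tangent
    plane at q is not horizontal, and the second-order condition makes the second
    fundamental form definite ([touching_paraboloid]): a contradiction.

    The unit normals, the connection, the tangent planes and the traces are given
    by descriptions. They are computed at interior points by [upward_unit_normalE],
    [nabla_extension], [tangent_conormal] and [trace_on_tangent]; the first and the
    curvature computations treat both metrics at once, with a sign s = 1 or -1. *)

(** * Coordinates and the Euclidean scalar product *)

Lemma sum3E {V : nmodType} (F : 'I_3 -> V) : \sum_i F i = F 0 + F 1 + F 2.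
Proof.
rewrite !big_ord_recl big_ord0 addr0 addrA.
by congr (_ + F _ + F _); apply/val_inj.
Qed.

Lemma row3P {T : Type} (u v : 'rV[T]_3) :
  u 0 0 = v 0 0 -> u 0 1 = v 0 1 -> u 0 2 = v 0 2 -> u = v.
Proof.
move=> uv0 uv1 uv2; apply/rowP => -[[|[|[|//]]] ?].
- by move: uv0; congr (u _ _ = v _ _); apply/val_inj.
- by move: uv1; congr (u _ _ = v _ _); apply/val_inj.
- by move: uv2; congr (u _ _ = v _ _); apply/val_inj.
Qed.

Lemma euclid_continuous {R : realType} (a : 'rV[R]_3) : continuous (euclid a).
Proof.
move=> x; rewrite /continuous_at /euclid.
have cc i : (fun z : 'rV[R]_3 => a 0 i * z 0 i) @ x --> a 0 i * x 0 i.
  exact: (cvgM (cvg_cst (a 0 i)) (@coord_continuous R 1 3 0 i x)).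
exact: cvgD (cvgD (cc 0) (cc 1)) (cc 2).
Qed.

Lemma euclid_sqr_continuous {R : realType} :
  continuous (fun x : 'rV[R]_3 => euclid x x).
Proof.
move=> x; rewrite /continuous_at /euclid.
have cc i : (fun z : 'rV[R]_3 => z 0 i) @ x --> x 0 i by exact: coord_continuous.
exact: cvgD (cvgD (cvgM (cc 0) (cc 0)) (cvgM (cc 1) (cc 1)))
            (cvgM (cc 2) (cc 2)).
Qed.

Lemma euclid_ge0 {R : realType} (a : 'rV[R]_3) : 0 <= euclid a a.
Proof. by rewrite /euclid -!expr2 !addr_ge0 ?sqr_ge0. Qed.

Lemma euclid_eq0 {R : realType} (a : 'rV[R]_3) : euclid a a = 0 -> a = 0.
Proof.
rewrite /euclid => /eqP; rewrite -!expr2 !paddr_eq0 ?addr_ge0 ?sqr_ge0//.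
rewrite !sqrf_eq0 => /andP[/andP[/eqP a0 /eqP a1] /eqP a2].
by apply: row3P; rewrite mxE.
Qed.

Lemma sqr_eq1 {R : realType} (s : R) : s ^+ 2 = 1 -> s = 1 \/ s = -1.
Proof. by move=> /eqP; rewrite sqrf_eq1 => /orP[/eqP|/eqP]; [left|right]. Qed.

(** * Convex hulls of compact sets *)

Definition combinations {R : realType} {d : nat} (n : nat) (K : set 'rV[R]_d)
    : set 'rV[R]_d :=
  [set z | exists (w : 'rV[R]_n) (X : 'I_n -> 'rV[R]_d),
    [/\ forall i, 0 <= w 0 i, \sum_i w 0 i = 1, forall i, K (X i) &
        z = \sum_i w 0 i *: X i]].

(** More than d + 1 points of a d-dimensional space are affinely dependent: the
    matrix with rows (1, X i) has at most d + 1 columns. The coefficients sum to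
    zero without all vanishing, so one of them is positive. *)
Lemma affine_dependence {R : realType} (d n : nat) (X : 'I_n -> 'rV[R]_d) :
  (d.+1 < n)%N ->
  exists m : 'rV[R]_n,
    [/\ exists i, 0 < m 0 i, \sum_i m 0 i = 0 & \sum_i m 0 i *: X i = 0].
Proof.
move=> dn.
pose M := row_mx (const_mx 1 : 'cV[R]_n) (\matrix_i X i).
have : kermx M != 0.
  rewrite kermx_eq0 /row_free neq_ltn; apply/orP; left.
  by apply: leq_ltn_trans dn; rewrite -[leqRHS]add1n rank_leq_col.
case/rowV0Pn => m /sub_kermxP; rewrite /M mul_mx_row => /eqP mM m0.
move: mM; rewrite row_mx_eq0 => /andP[/eqP m1 /eqP mX].
have summ : \sum_i m 0 i = 0.
  move/matrixP/(_ 0 0): m1; rewrite !mxE => sm; rewrite -[RHS]sm.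
  by apply: eq_bigr => i _; rewrite mxE mulr1.
exists m; split=> //; last first.
  by rewrite -[RHS]mX mulmx_sum_row; apply: eq_bigr => i _; rewrite rowK.
apply/not_existsP => mneg.
have mle i : 0 <= - m 0 i by rewrite oppr_ge0 leNgt; apply/negP/mneg.
have : \sum_i - m 0 i == 0 by rewrite sumrN summ oppr0.
rewrite psumr_eq0// => /allP mall.
move/negP: m0; apply; apply/eqP/rowP => i; rewrite mxE.
by apply/eqP; rewrite -oppr_eq0; apply: mall; rewrite mem_index_enum.
Qed.

(** Moving the weights along an affine dependence changes neither the point nor
    the total weight. One moves until the first weight vanishes, and that point
    can then be dropped. *)
Lemma combinations_step {R : realType} (d n : nat) (K : set 'rV[R]_d) :
  (d < n)%N -> combinations n.+1 K `<=` combinations n K.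
Proof.
move=> dn z [w [X [w0 w1 KX ->]]].
have [m [[i0 mi0] m1 mX]] := affine_dependence X dn.
have [i mi imin] := @Order.TotalTheory.arg_minP _ _ _ i0
  (fun i => 0 < m 0 i) (fun i => w 0 i / m 0 i) mi0.
(* the largest step that keeps all weights nonnegative *)
pose t := w 0 i / m 0 i.
have t0 : 0 <= t by rewrite divr_ge0 ?w0 ?ltW.
pose w' := w - t *: m.
have w'i : w' 0 i = 0.
  by rewrite !mxE /t divfK ?subrr// gt_eqF.
have w'0 j : 0 <= w' 0 j.
  rewrite !mxE subr_ge0; have [mj|mj] := ltP 0 (m 0 j).
    by rewrite -ler_pdivlMr//; exact: imin.
  by apply: le_trans (w0 j); rewrite mulr_ge0_le0.
have sumw' : \sum_j w' 0 j = 1.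
  under eq_bigr do rewrite !mxE.
  by rewrite sumrB w1 -mulr_sumr m1 mulr0 subr0.
have sumX : \sum_j w' 0 j *: X j = \sum_j w 0 j *: X j.
  under eq_bigr do rewrite !mxE scalerBl -scalerA.
  by rewrite sumrB -scaler_sumr mX scaler0 subr0.
exists (\row_j w' 0 (lift i j)), (X \o lift i); split=> [j||j|] /=.
- by rewrite mxE.
- rewrite -sumw' (bigD1_ord i)//= w'i add0r.
  by apply: eq_bigr => j _; rewrite mxE.
- exact: KX.
- rewrite -sumX (bigD1_ord i)//= w'i scale0r add0r.
  by apply: eq_bigr => j _; rewrite mxE.
Qed.

Lemma caratheodory {R : realType} (d n : nat) (K : set 'rV[R]_d) :
  combinations (d.+1 + n) K `<=` combinations d.+1 K.
Proof.
elim: n => [|n IH]; first by rewrite addn0.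
rewrite addnS; apply: subset_trans IH.
by apply: combinations_step; rewrite leq_addr.
Qed.

(** A combination of two combinations is one of twice as many points, which
    Caratheodory's reduction brings back to d + 1 points. *)
Lemma combinations_segment {R : realType} (d : nat) (K : set 'rV[R]_d) x y t :
  0 <= t -> t <= 1 -> combinations d.+1 K x -> combinations d.+1 K y ->
  combinations d.+1 K (t *: x + (1 - t) *: y).
Proof.
move=> t0 t1 [w [X [w0 w1 KX ->]]] [v [Y [v0 v1 KY ->]]].
apply: (@caratheodory R d d.+1).
exists (row_mx (t *: w) ((1 - t) *: v)).
exists (fun i => match fintype.split i with inl j => X j | inr j => Y j end).
split.
- move=> i; rewrite -(splitK i); case: (fintype.split i) => j /=.
    by rewrite row_mxEl mxE mulr_ge0.
  by rewrite row_mxEr mxE mulr_ge0// subr_ge0.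
- rewrite big_split_ord/=.
  under eq_bigr do rewrite row_mxEl mxE.
  under [X in _ + X]eq_bigr do rewrite row_mxEr mxE.
  by rewrite -!mulr_sumr w1 v1 !mulr1 addrC subrK.
- by move=> i; case: (fintype.split i).
- rewrite [RHS]big_split_ord/= !scaler_sumr; congr (_ + _); apply: eq_bigr => i _.
    by rewrite row_mxEl mxE scalerA -/(unsplit (inl i)) unsplitK.
  by rewrite row_mxEr mxE scalerA -/(unsplit (inr i)) unsplitK.
Qed.


(** Split off the first point; the other weights, divided by their sum, form a
    combination of one point fewer. *)
Lemma combinations_convex_hull {R : realType} (n : nat) (K : set 'rV[R]_3) :
  combinations n K `<=` convex_hull K.
Proof.
move=> z Dz C [Cconv KC]; elim: n z Dz => [|n IH] z [w [X [w0 w1 KX ->]]].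
  by move: w1; rewrite big_ord0 => /eqP; rewrite eq_sym oner_eq0.
move: w1; rewrite !big_ord_recl/= => w1.
have wlast0 : 0 <= \sum_(i < n) w 0 (lift ord0 i) by apply: sumr_ge0.
(* if the first point has all the weight, the other weights cannot be normalised *)
have [w01|w01] := eqVneq (w 0 ord0) 1.
  have /eqP : \sum_(i < n) w 0 (lift ord0 i) = 0.
    by apply: (addrI (w 0 ord0)); rewrite w1 w01 addr0.
  rewrite psumr_eq0// => /allP wz.
  rewrite big1 => [|i _]; first by rewrite w01 scale1r addr0; exact: KC.
  by have /eqP -> := wz i (mem_index_enum _); rewrite scale0r.
have w0n : 1 - w 0 ord0 != 0 by rewrite subr_eq0 eq_sym.
have w0le : w 0 ord0 <= 1 by rewrite -w1 lerDl.
have w0i : Itv.spec (@Itv.num_sem R) (Itv.Real `[0, 1]%Z) (w 0 ord0).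
  by rewrite /= /Itv.num_sem/= realE/= w0//= in_itv/= w0 w0le.
set y := \sum_(i < n) _.
have Cy : C ((1 - w 0 ord0)^-1 *: y).
  apply: IH; exists (\row_i ((1 - w 0 ord0)^-1 * w 0 (lift ord0 i))).
  exists (X \o lift ord0); split=> [i||i|] /=.
  - by rewrite mxE mulr_ge0// invr_ge0 subr_ge0.
  - under eq_bigr do rewrite mxE.
    rewrite -mulr_sumr -w1 addrC addKr mulVf//.
    by rewrite -(addKr (w 0 ord0) (\sum_(i < n) _)) w1 addrC.
  - exact: KX.
  - by rewrite scaler_sumr; apply: eq_bigr => i _; rewrite mxE scalerA.
have := Cconv (X ord0) _ (Itv.mk w0i) (mem_set (KC _ (KX ord0))) (mem_set Cy).
rewrite inE; congr C; congr (_ + _).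
change ((1 - w 0 ord0) *: ((1 - w 0 ord0)^-1 *: y) = y).
by rewrite scalerA divff// scale1r.
Qed.

Lemma row_entry_continuous {R : realType} (d n : nat) (i : 'I_n) :
  continuous (fun X : 'rV['rV[R]_d]_n => X 0 i).
Proof.
move=> X s /= /(nbhs_ballP (X 0 i))[e e0 es].
by apply/nbhs_ballP; exists e => //= N [_ MN]; exact/es/MN.
Qed.

Lemma simplex_compact {R : realType} (n : nat) :
  compact [set w : 'rV[R]_n | (forall i, 0 <= w 0 i) /\ \sum_i w 0 i = 1].
Proof.
apply: (@subclosed_compact _ _ [set w : 'rV[R]_n | forall i, `[0, 1]%classic (w 0 i)]).
- rewrite (_ : [set _ | _] =
    (\bigcap_(i : 'I_n) ((fun w : 'rV[R]_n => w 0 i) @^-1` [set x | 0 <= x])) `&`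
    ((fun w : 'rV[R]_n => \sum_i w 0 i) @^-1` [set 1])); last first.
    apply/seteqP; split=> w /= [w0 w1]; split=> // i; first by move=> _; exact: w0.
    exact: w0.
  apply: closedI.
    apply: closed_bigI => i _; apply: closed_comp; last exact: closed_ge.
    by move=> w _; exact: coord_continuous.
  apply: closed_comp; last exact: closed_eq.
  move=> w _; apply: (continuous_big (@add_continuous _)) => i _.
  exact: coord_continuous.
- by apply: (@rV_compact R n (fun=> `[0, 1]%classic)) => i; exact: segment_compact.
- move=> w /= [w0 w1] i; rewrite in_itv/= w0/= -w1 (bigD1 i)//= lerDl.
  by apply: sumr_ge0 => j _.
Qed.

(** The number of points being fixed, the barycentre is a continuous function of
    the weights, which range over a simplex, and of the points. This is where a
    bound on the number of points matters. *)
Lemma combinations_compact {R : realType} (d n : nat) (K : set 'rV[R]_d) :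
  compact K -> compact (combinations n K).
Proof.
move=> Kc.
pose bary (wX : 'rV[R]_n * 'rV['rV[R]_d]_n) := \sum_i wX.1 0 i *: wX.2 0 i.
rewrite (_ : combinations n K = bary @`
    ([set w : 'rV[R]_n | (forall i, 0 <= w 0 i) /\ \sum_i w 0 i = 1] `*`
     [set X : 'rV['rV[R]_d]_n | forall i, K (X 0 i)])); last first.
  apply/seteqP; split=> z.
    move=> [w [X [w0 w1 KX ->]]]; exists (w, \row_i X i) => /=.
      by split=> //= i; rewrite mxE; exact: KX.
    by rewrite /bary/=; apply: eq_bigr => i _; rewrite mxE.
  move=> [[w X] /= [[w0 w1] KX] <-].
  by exists w, (fun i => X 0 i); split.
apply: continuous_compact; last first.
  by apply: compact_setX; [exact: simplex_compact|exact: (@rV_compact _ n (fun=> K))].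
apply: continuous_subspaceT.
apply: (continuous_big (@add_continuous _)) => i _ wX; apply: cvgZ.
  apply: (@continuous_comp _ _ _ fst (fun w : 'rV[R]_n => w 0 i)).
    exact: cvg_fst.
  exact: coord_continuous.
apply: (@continuous_comp _ _ _ snd (fun X : 'rV['rV[R]_d]_n => X 0 i)).
  exact: cvg_snd.
exact: row_entry_continuous.
Qed.

(** The functional is x |-> <p - d0, x>, where d0 is the point nearest to p of the
    compact convex set of four-point combinations of K. *)
Lemma strict_separation {R : realType} (K : set 'rV[R]_3) (p : 'rV[R]_3) :
  compact K -> K !=set0 -> ~ convex_hull K p ->
  exists (a : 'rV[R]_3) (delta : R),
    0 < delta /\ forall k, K k -> delta <= euclid a (p - k).
Proof.
move=> Kc [k0 Kk0] Hp.
have K_comb k : K k -> combinations 4 K k.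
  move=> Kk; exists (\row_i (i == 0)%:R), (fun=> k); split=> // [i||].
  - by rewrite mxE.
  - by rewrite !big_ord_recl big_ord0/= !mxE/= !addr0.
  - by rewrite !big_ord_recl big_ord0/= !mxE/= !scale0r scale1r !addr0.
pose dist (z : 'rV[R]_3) : R := euclid (p - z) (p - z).
have dist_cont : continuous dist.
  move=> z; apply: (@continuous_comp _ _ _ (fun z : 'rV[R]_3 => p - z)
    (fun z : 'rV[R]_3 => euclid z z)).
    exact: (@cvgB R 'rV[R]_3 _ (nbhs z) _ (cst p) id p z (cvg_cst p) cvg_id).
  exact: euclid_sqr_continuous.
have [||d0 dD dmin] := @compact_EVT_min _ _ dist (combinations 4 K) _
  (@combinations_compact _ _ 4 _ Kc).
- by exists k0; exact: K_comb.
- exact: continuous_subspaceT.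
rewrite inE in dD.
pose a := p - d0.
have a0 : 0 < euclid a a.
  rewrite lt_def euclid_ge0 andbT; apply/eqP => /euclid_eq0/eqP.
  rewrite subr_eq0 => /eqP pd; apply: Hp.
  by rewrite pd; exact: combinations_convex_hull dD.
exists a, (euclid a a); split=> // k Kk.
rewrite leNgt; apply/negP => ak.
pose u := k - d0.
have au : 0 < euclid a u.
  have -> : euclid a u = euclid a a - euclid a (p - k).
    by rewrite /euclid /a /u !mxE; ring.
  by rewrite subr_gt0.
pose s := euclid a u; pose q := euclid u u.
have q0 : 0 <= q by exact: euclid_ge0.
have sq0 : 0 < s + q by rewrite ltr_wpDr.
(* towards k the squared distance changes by t (t q - 2 s), negative at this t *)
pose t := s / (s + q).
have t0 : 0 < t by rewrite divr_gt0.
have t1 : t <= 1 by rewrite ler_pdivrMr// mul1r lerDl.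
have := dmin (t *: k + (1 - t) *: d0).
rewrite inE => /(_ (combinations_segment (ltW t0) t1 (K_comb _ Kk) dD)).
have -> : dist (t *: k + (1 - t) *: d0) = dist d0 - t * (2 * s - t * q).
  by rewrite /dist /s /q /a /u /euclid !mxE; ring.
rewrite lerBrDr gerDl leNgt => /negP; apply.
rewrite mulr_gt0// subr_gt0 /t mulrAC ltr_pdivrMr//.
by rewrite /s /q in q0 sq0 au *; nra.
Qed.

(** * Curves and second-order conditions *)

Lemma is_derive_curve {R : realType} {V W : normedModType R} (f : V -> W)
    (c : R -> V) (t : R) (v : V) :
  is_derive t 1 c v -> differentiable f (c t) ->
  is_derive t 1 (f \o c) ('d f (c t) v).
Proof.
move=> cv df.
have dc : differentiable c t by apply/derivable1_diffP; exact: ex_derive.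
apply: DeriveDef.
  by apply/derivable1_diffP; exact: differentiable_comp.
rewrite deriveE; last exact: differentiable_comp.
by rewrite diff_comp//= -(deriveE _ dc) (@derive_val _ _ _ _ _ _ _ cv).
Qed.

Lemma diff_coord {R : realType} {n : nat} (i : 'I_n) (x : 'rV[R]_n) :
  is_diff x (fun y : 'rV[R]_n => y 0 i) (fun v => v 0 i).
Proof.
apply: DiffDef; first exact: differentiable_coord.
apply/funext => v; rewrite -deriveE; last exact: differentiable_coord.
rewrite /derive (_ : (fun h : R => _) = fun h : R => h^-1 * (h * v 0 i)); last first.
  by apply/funext => h /=; rewrite !mxE addrK.
apply: lim_near_cst => //; near=> h; rewrite mulKf//.
by near: h; exact: nbhs_dnbhs_neq.
Unshelve. all: by end_near. Qed.

Lemma is_derive_coord {R : realType} {n : nat} (c : R -> 'rV[R]_n) (t : R)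
    (v : 'rV[R]_n) (i : 'I_n) :
  is_derive t 1 c v -> is_derive t 1 (fun t => c t 0 i) (v 0 i).
Proof.
move=> cv; have dc := diff_coord i (c t).
have := is_derive_curve cv (differentiable_coord (c t) 0 i).
by rewrite diff_val.
Qed.

Lemma is_derive_euclid {R : realType} (u w : R -> 'rV[R]_3) (t : R)
    (u' w' : 'rV[R]_3) :
  is_derive t 1 u u' -> is_derive t 1 w w' ->
  is_derive t 1 (fun t => euclid (u t) (w t))
    (euclid u' (w t) + euclid (u t) w').
Proof.
move=> du dw.
have P i := is_deriveM (is_derive_coord i du) (is_derive_coord i dw).
apply: (is_derive_eq (is_deriveD (is_deriveD (P 0) (P 1)) (P 2))).
by rewrite /euclid /GRing.scale/=; ring.
Qed.

Lemma differentiable_row {R : realType} {V : normedModType R} {n : nat}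
    (f : V -> 'rV[R]_n) (x : V) :
  (forall i, differentiable (fun y => f y 0 i) x) -> differentiable f x.
Proof.
move=> df.
have -> : f = \sum_(i < n) (fun y => f y 0 i *: delta_mx 0 i).
  by apply/funext => y; rewrite fct_sumE; exact: row_sum_delta.
by apply: differentiable_sum => i; exact: differentiableZl.
Qed.

Lemma local_max_derive {R : realType} (k k' : R -> R) :
  (\forall t \near (0 : R), is_derive (t : R) 1 k (k' t)) ->
  (\forall t \near (0 : R), k t <= k 0) -> k' 0 = 0.
Proof.
move=> dk kmax.
have /nbhs_ballP[e /= e0 He] : \forall t \near (0 : R),
  is_derive (t : R) 1 k (k' t) /\ k t <= k 0 by near=> t; split; near: t.
have He' (t : R) : t \in `](- e), e[ -> is_derive (t : R) 1 k (k' t) /\ k t <= k 0.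
  rewrite in_itv/= -ltr_norml => te; apply: He.
  by rewrite /ball/= sub0r normrN.
have e0' : 0 \in `](- e), e[ by rewrite in_itv/= oppr_lt0 e0.
have Z : is_derive (0 : R) 1 k 0.
  apply: (@derive1_at_max _ k (- e) e 0 _ _ e0') => [|t te|t te].
  - by rewrite ge0_cp// ltW.
  - by have [? _] := He' t te; exact: ex_derive.
  - by have [] := He' t te.
have [dk0 _] := He' 0 e0'.
by rewrite -(@derive_val _ _ _ _ _ _ _ dk0) (@derive_val _ _ _ _ _ _ _ Z).
Unshelve. all: by end_near. Qed.

(** If l > 0, the derivative k' is positive just after 0, and by the mean value
    theorem k exceeds k 0 there. *)
Lemma local_max_derive2 {R : realType} (k k' : R -> R) (l : R) :
  (\forall t \near (0 : R), is_derive (t : R) 1 k (k' t)) ->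
  (\forall t \near (0 : R), k t <= k 0) -> is_derive (0 : R) 1 k' l ->
  l <= 0.
Proof.
move=> dk kmax dk'; rewrite leNgt; apply/negP => l0.
have k'0 := local_max_derive dk kmax.
have quot : h^-1 * k' h @[h --> (0 : R)^'] --> l.
  have [/= + dl] := dk'; move=> /cvg_ex[l' cl'].
  have ll' : l' = l by rewrite -dl; apply/esym/cvg_lim.
  rewrite -ll'; apply: cvg_trans cl'; apply: near_eq_cvg; near=> h.
  by rewrite /= k'0 subr0 addr0 [h *: 1]mulr1.
have k'pos : \forall h \near (0 : R)^', 0 < h^-1 * k' h.
  by apply: (cvgr_gt l quot).
have /nbhs_ballP[e /= e0 He] : \forall t \near (0 : R),
   [/\ is_derive (t : R) 1 k (k' t), k t <= k 0 & (t != 0 -> 0 < t^-1 * k' t)].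
  by near=> t; split; near: t.
pose b := e / 2.
have b0 : 0 < b by rewrite divr_gt0.
have Hb (t : R) : 0 <= t -> t <= b ->
   [/\ is_derive (t : R) 1 k (k' t), k t <= k 0 & (t != 0 -> 0 < t^-1 * k' t)].
  move=> t0 tb; apply: He; rewrite /ball/= sub0r normrN ger0_norm//.
  by rewrite (le_lt_trans tb)// /b ltr_pdivrMr// ltr_pMr// ltr1n.
have [c|c|c cb kc] := @MVT _ k k' 0 b b0.
- by rewrite in_itv/= => /andP[c0 cb]; have [] := Hb c (ltW c0) (ltW cb).
- apply: derivable_within_continuous => t; rewrite in_itv/= => /andP[t0 tb].
  by have [? _ _] := Hb t t0 tb; exact: ex_derive.
have [c0 clb] : 0 < c /\ c < b by move: cb; rewrite in_itv/= => /andP.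
have [_ _ k'c] := Hb c (ltW c0) (ltW clb).
have [_ kb _] := Hb b (ltW b0) (lexx _).
have : 0 < k b - k 0.
  rewrite kc subr0 mulr_gt0//.
  by have := k'c (lt0r_neq0 c0); rewrite pmulr_rgt0// invr_gt0.
by rewrite subr_gt0 ltNge kb.
Unshelve. all: by end_near. Qed.

(** * Charts and curves on a surface *)

(** The gradient of the third coordinate of phi: a surface flattened by phi is
    the zero set of that coordinate. *)
Definition conormal {R : realType} (phi : 'rV[R]_3 -> 'rV[R]_3)
    (x : 'rV[R]_3) : 'rV[R]_3 :=
  \row_i ('D_(delta_mx 0 i) phi x) 0 2.

Lemma conormalE {R : realType} (phi : 'rV[R]_3 -> 'rV[R]_3) (x v : 'rV[R]_3) :
  differentiable phi x -> euclid (conormal phi x) v = ('d phi x v) 0 2.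
Proof.
move=> dphi; rewrite [in RHS](row_sum_delta v) linear_sum summxE sum3E.
by rewrite /euclid !linearZ/= !mxE !deriveE//; ring.
Qed.

Lemma conormal_differentiable {R : realType} (U : set 'rV[R]_3)
    (phi : 'rV[R]_3 -> 'rV[R]_3) (x : 'rV[R]_3) :
  smooth_on U phi -> U x -> differentiable (conormal phi) x.
Proof.
move=> phiU Ux; apply: differentiable_row => i.
have [_ /(_ (delta_mx 0 i))[dD _]] := phiU 2%N.
have -> : (fun y => conormal phi y 0 i) =
    (fun N : 'rV[R]_3 => N 0 2) \o 'D_(delta_mx 0 i) phi.
  by apply/funext => y; rewrite mxE.
apply: differentiable_comp.
  exact: dD.
exact: differentiable_coord.
Qed.

Lemma smooth_differentiable {R : realType} (U : set 'rV[R]_3)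
    (f : 'rV[R]_3 -> 'rV[R]_3) (x : 'rV[R]_3) :
  smooth_on U f -> U x -> differentiable f x.
Proof. by move=> fU; have [df _] := fU 1%N; exact: df. Qed.

Lemma diff_inverse {R : realType} {V : normedModType R} (f g : V -> V) (x v : V) :
  differentiable f x -> differentiable g (f x) ->
  (\forall y \near x, g (f y) = y) -> 'd g (f x) ('d f x v) = v.
Proof.
move=> df dg gf; rewrite -[LHS]/(('d g (f x) \o 'd f x) v) -diff_comp//.
rewrite -deriveE; last exact: differentiable_comp.
by rewrite (@near_eq_derive _ _ _ (g \o f) id)// derive_id.
Qed.

(** The last clause keeps the velocity tangent at every time, not only at 0; it
    is what allows differentiating the tangency once more. *)
Definition moves_on {R : realType} (S U : set 'rV[R]_3)
    (phi : 'rV[R]_3 -> 'rV[R]_3) (c c' : R -> 'rV[R]_3) (t : R) : Prop :=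
  [/\ S (c t), U (c t), is_derive t 1 c (c' t) &
      euclid (conormal phi (c t)) (c' t) = 0].

Section Chart.
Variables (R : realType) (S U W : set 'rV[R]_3) (x : 'rV[R]_3).
Variables (phi psi : 'rV[R]_3 -> 'rV[R]_3).

Lemma chart_at_point (M : set 'rV[R]_3) (y : 'rV[R]_3) :
  chart_at M S x U W phi psi -> U y -> chart_at M S y U W phi psi.
Proof. by move=> [[oU _] oW sphi spsi H] Uy; split. Qed.

Lemma chart_diff_psi_phi (M : set 'rV[R]_3) v :
  chart_at M S x U W phi psi -> 'd psi (phi x) ('d phi x v) = v.
Proof.
move=> [[oU Ux] oW sphi spsi [phiW psiU _]].
have [Wx _] := phiW x Ux.
apply: diff_inverse; [exact: smooth_differentiable sphi Ux|
  exact: smooth_differentiable spsi Wx|].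
near=> y; have [//|_ ->//] := phiW y.
by near: y; exact: open_nbhs_nbhs.
Unshelve. all: by end_near. Qed.

Lemma chart_diff_phi_psi (M : set 'rV[R]_3) y v :
  chart_at M S x U W phi psi -> W y -> 'd phi (psi y) ('d psi y v) = v.
Proof.
move=> [[oU Ux] oW sphi spsi [phiW psiU _]] Wy.
have [Uy _] := psiU y Wy.
apply: diff_inverse; [exact: smooth_differentiable spsi Wy|
  exact: smooth_differentiable sphi Uy|].
near=> z; have [//|_ ->//] := psiU z.
by near: z; exact: open_nbhs_nbhs.
Unshelve. all: by end_near. Qed.

Lemma chart_plane_mem y :
  chart_at plane S x U W phi psi -> U y -> S y <-> phi y 0 2 = 0.
Proof.
move=> [_ _ _ _ [phiW psiU phiS]] Uy; have [Wy psiphi] := phiW y Uy; split=> [Sy|py].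
  have : (plane `&` W) (phi y) by rewrite -phiS; exists y.
  by case.
have : (phi @` (S `&` U)) (phi y) by rewrite phiS.
case=> z [Sz Uz] /(congr1 psi).
by have [_ ->] := phiW z Uz; rewrite psiphi => <-.
Qed.

Lemma conormal_neq0 (M : set 'rV[R]_3) :
  chart_at M S x U W phi psi -> conormal phi x != 0.
Proof.
move=> ch; have [[oU Ux] oW sphi spsi [phiW psiU _]] := ch.
have [Wx psiphi] := phiW x Ux.
have := chart_diff_phi_psi (delta_mx 0 2) ch Wx; rewrite psiphi => /matrixP/(_ 0 2).
rewrite -conormalE; last exact: smooth_differentiable sphi Ux.
rewrite mxE !eqxx/= => H; apply/eqP => n0.
by move/eqP: H; rewrite n0 /euclid !mxE !mul0r !addr0 eq_sym oner_eq0.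
Qed.

(** The preimage under the chart of the segment that starts at phi x in the
    direction 'd phi x v, which stays in the plane. *)
Lemma chart_curve v :
  chart_at plane S x U W phi psi -> S x -> euclid (conormal phi x) v = 0 ->
  exists c c' : R -> 'rV[R]_3,
    [/\ c 0 = x, c' 0 = v, derivable c' 0 1 &
      \forall t \near (0 : R), moves_on S U phi c c' t].
Proof.
move=> ch Sx; have [[oU Ux] oW sphi spsi [phiW psiU _]] := ch.
have [Wx psiphi] := phiW x Ux.
rewrite conormalE; last exact: smooth_differentiable sphi Ux.
set e := 'd phi x v => e2.
pose l (t : R) : 'rV[R]_3 := phi x + t *: e.
have dl (t : R) : is_derive t 1 l e.
  have de : is_derive t 1 (fun t : R => t *: e) e.
    have ds : differentiable (fun t : R => t *: e) t.
      by apply: (@differentiableZl _ _ _ id).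
    apply: DeriveDef; first exact/derivable1_diffP.
    by rewrite deriveE// (@diffZl _ _ _ id)// diff_val scale1r.
  exact: is_derive_eq (is_deriveD (is_derive_cst (phi x) t 1) de) (add0r e).
have lW : \forall t \near (0 : R), W (l t).
  have lc : {for 0, continuous l}.
    by apply/differentiable_continuous/derivable1_diffP; exact: ex_derive.
  by apply: lc; rewrite /l scale0r addr0; exact: open_nbhs_nbhs.
exists (psi \o l), (fun t => 'd psi (l t) e).
have l0 : l 0 = phi x by rewrite /l scale0r addr0.
split.
- by rewrite /= l0.
- by rewrite l0; exact: chart_diff_psi_phi ch.
- have [_ /(_ e)[dDpsi _]] := spsi 2%N.
  apply: (@near_eq_derivable _ _ _ ('D_e psi \o l)).
    near=> t; rewrite /= deriveE//; apply: smooth_differentiable spsi _.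
    by near: t.
  apply/derivable1_diffP/differentiable_comp.
    by apply/derivable1_diffP; exact: ex_derive.
  by rewrite l0; exact: dDpsi.
- near=> t.
  have Wt : W (l t) by near: t.
  have [Ut phipsi] := psiU _ Wt; split=> //.
  + apply/(chart_plane_mem ch Ut).
    by rewrite /= phipsi !mxE e2 mulr0 addr0; exact/(chart_plane_mem ch Ux).
  + by apply: is_derive_curve => //; exact: smooth_differentiable spsi Wt.
  + rewrite conormalE; last exact: smooth_differentiable sphi Ut.
    by rewrite (chart_diff_phi_psi _ ch Wt).
Unshelve. all: by end_near. Qed.

End Chart.

(** * Tangent planes, covariant derivatives and traces *)

(** Two linear forms with nested kernels are proportional. The conclusion is that
    the minors of the pair vanish, which avoids dividing by a coordinate of n. *)
Lemma proportional_of_orthogonal {R : realType} (n m : 'rV[R]_3) :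
  (forall v, euclid n v = 0 -> euclid m v = 0) ->
  forall i j, m 0 i * n 0 j = m 0 j * n 0 i.
Proof.
move=> nm i j.
pose v : 'rV[R]_3 := n 0 j *: delta_mx 0 i - n 0 i *: delta_mx 0 j.
have euclid_v (u : 'rV[R]_3) : euclid u v = u 0 i * n 0 j - u 0 j * n 0 i.
  have -> : euclid u v = \sum_k u 0 k * v 0 k by rewrite sum3E.
  rewrite /v; under eq_bigr do rewrite !mxE /= mulrBr.
  rewrite sumrB (bigD1 i)//= [in X in _ - X](bigD1 j)//= !eqxx !mulr1.
  rewrite !big1 ?addr0// => k /negPf kij; first by rewrite kij !mulr0.
  by rewrite kij !mulr0.
apply/eqP; rewrite -subr_eq0 -euclid_v; apply/eqP/nm.
by rewrite euclid_v mulrC subrr.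
Qed.

(** The tangent plane is defined from all charts, so another chart phi' must give
    the same plane. A curve that realises a tangent vector for phi stays in the
    surface, where the third coordinate of phi' vanishes; hence the kernel of the
    first conormal is contained in that of the second, and both are planes. For
    this argument phi' may equally well be a chart onto the half-plane. *)
Lemma tangent_conormal {R : realType} (S U W : set 'rV[R]_3) (x v : 'rV[R]_3)
    (phi psi : 'rV[R]_3 -> 'rV[R]_3) :
  chart_at plane S x U W phi psi -> S x ->
  tangent S x v <-> euclid (conormal phi x) v = 0.
Proof.
move=> ch Sx; have [[oU Ux] _ sphi _ _] := ch.
split; last first.
  move=> nv; exists U, W, phi, psi; split; first by left.
  by rewrite /plane/= -conormalE//; exact: smooth_differentiable sphi Ux.
case=> U' [W' [phi' [psi' [ch' Tv]]]].
have [n'0 [oU' U'x] sphi' phi'S] : [/\ conormal phi' x != 0, open U' /\ U' x,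
    smooth_on U' phi' & forall y, S y -> U' y -> phi' y 0 2 = 0].
  case: ch' => ch'; (split; first exact: conormal_neq0 ch';
    case: ch' => // ? ? ? ? [_ _ H] y Sy Uy).
    have : (phi' @` (S `&` U')) (phi' y) by exists y.
    by rewrite H => -[].
  have : (phi' @` (S `&` U')) (phi' y) by exists y.
  by rewrite H => -[[]].
have dphi' := smooth_differentiable sphi' U'x.
have n'v : euclid (conormal phi' x) v = 0 by rewrite conormalE.
have sub w : euclid (conormal phi x) w = 0 -> euclid (conormal phi' x) w = 0.
  move=> nw; have [c [c' [c0 c'0 _ Hc]]] := chart_curve ch Sx nw.
  have [_ _ dc _] := nbhs_singleton Hc.
  have dphic : differentiable phi' (c 0) by rewrite c0.
  have := is_derive_coord 2 (is_derive_curve dc dphic).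
  rewrite c0 c'0 conormalE// => D1.
  have cU' : \forall t \near (0 : R), U' (c t).
    have cc : {for 0, continuous c}.
      by apply/differentiable_continuous/derivable1_diffP; exact: ex_derive.
    by apply: cc; rewrite c0; exact: open_nbhs_nbhs.
  rewrite -(@derive_val _ _ _ _ _ _ _ D1).
  rewrite (@near_eq_derive _ _ _ _ (cst 0)) ?derive_cst//.
  near=> t; apply: phi'S; last by near: t.
  by have [] : moves_on S U phi c c' t by near: t.
have prop := proportional_of_orthogonal sub.
have key j : conormal phi' x 0 j * euclid (conormal phi x) v = 0.
  rewrite /euclid !mulrDr !mulrA !(prop j) -!mulrA.
  rewrite -(mulr0 (conormal phi x 0 j)) -n'v /euclid; ring.
apply/eqP; move: n'0; apply: contraNT => nv; apply/eqP/rowP => j.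
rewrite [RHS]mxE.
by apply/eqP; have /eqP := key j; rewrite mulf_eq0 (negPf nv) orbF.
Unshelve. all: by end_near. Qed.

(** Two differentiable extensions of the same field agree along any curve of the
    surface, hence have the same derivative in tangent directions. *)
Lemma nabla_extension {R : realType} (S U W : set 'rV[R]_3) (x v : 'rV[R]_3)
    (phi psi Y Z : 'rV[R]_3 -> 'rV[R]_3) :
  chart_at plane S x U W phi psi -> S x -> euclid (conormal phi x) v = 0 ->
  (\forall y \near x, S y -> Z y = Y y) -> differentiable Z x ->
  nabla S Y x v = 'd Z x v.
Proof.
move=> ch Sx nv ZY dZ; apply: get_unique; first by exists Z.
move=> w [Z' [Z'Y dZ' ->]].
have [c [c' [c0 c'0 _ Hc]]] := chart_curve ch Sx nv.
have [_ _ dc _] := nbhs_singleton Hc.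
have dZc : differentiable Z (c 0) by rewrite c0.
have dZ'c : differentiable Z' (c 0) by rewrite c0.
have := is_derive_curve dc dZc; have := is_derive_curve dc dZ'c.
rewrite c0 c'0 => D1 D2.
apply: etrans (esym (@derive_val _ _ _ _ _ _ _ D1)) _.
apply: etrans (@derive_val _ _ _ _ _ _ _ D2); apply: near_eq_derive.
have cc : c @ (0 : R) --> x.
  rewrite -c0.
  by apply/differentiable_continuous/derivable1_diffP; exact: ex_derive.
have cZ : \forall t \near (0 : R), S (c t) -> Z (c t) = Y (c t).
  exact: cc _ ZY.
have cZ' : \forall t \near (0 : R), S (c t) -> Z' (c t) = Y (c t).
  exact: cc _ Z'Y.
near=> t; have St : S (c t).
  by have [] : moves_on S U phi c c' t by near: t.
transitivity (Y (c t)); first by move: St; near: t.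
by apply/esym; move: St; near: t.
Unshelve. all: by end_near. Qed.

(** L takes its values in the plane T, so L = K *m B for a basis B of T. The
    matrix of the restriction of L in that basis is B *m K, and the traces of
    K *m B and B *m K agree. *)
Lemma trace_on_tangent {R : realType} (T : set 'rV[R]_3) (n : 'rV[R]_3)
    (f : 'rV[R]_3 -> 'rV[R]_3) (L : 'M[R]_3) :
  n != 0 -> (forall v, T v <-> euclid n v = 0) ->
  (forall v, T v -> f v = v *m L) -> (forall v, euclid n (v *m L) = 0) ->
  trace_on T f = \tr L.
Proof.
move=> n0 TE fL nL.
have euclid_tr (v : 'rV[R]_3) : (v *m n^T) 0 0 = euclid n v.
  by rewrite !mxE sum3E !mxE /euclid; ring.
have euclid_ker (v : 'rV[R]_3) : euclid n v = 0 <-> (v <= kermx n^T)%MS.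
  split=> [nv|/sub_kermxP vn]; last by rewrite -euclid_tr vn mxE.
  by apply/sub_kermxP/rowP => i; rewrite ord1 euclid_tr nv mxE.
apply: get_unique.
  have rk : \rank (kermx n^T) = 2%N.
    by rewrite mxrank_ker mxrank_tr rank_rV n0.
  have [B [Bfree BT]] : exists B : 'M[R]_(2, 3),
      row_free B /\ forall v : 'rV[R]_3, T v <-> (v <= B)%MS.
    have : exists B : 'M[R]_(\rank (kermx n^T), 3), row_free B /\
        forall v : 'rV[R]_3, T v <-> (v <= B)%MS.
      exists (row_base (kermx n^T)); split; first exact: row_base_free.
      move=> v; rewrite TE euclid_ker.
      by rewrite eq_row_base.
    by rewrite rk.
  have LB : (L <= B)%MS.
    apply/row_subP => i; apply/BT/TE.
    by rewrite rowE.
  have LE : L = L *m pinvmx B *m B by rewrite mulmxKpV.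
  exists B, (B *m (L *m pinvmx B)); split=> //.
    move=> i; rewrite fL; last by apply/BT; exact: row_sub.
    by rewrite {1}LE row_mul !mulmxA.
  by rewrite mxtrace_mulC -LE.
move=> t [B [M [Bfree BT fB ->]]].
have LB : (L <= B)%MS.
  by apply/row_subP => i; apply/BT/TE; rewrite rowE.
have LE : L = L *m pinvmx B *m B by rewrite mulmxKpV.
have BM : B *m L = M *m B.
  apply/row_matrixP => i; rewrite !row_mul -fB fL//.
  by apply/BT; exact: row_sub.
have -> : M = B *m (L *m pinvmx B).
  by apply: (row_free_inj Bfree); rewrite -BM {1}LE !mulmxA.
by rewrite mxtrace_mulC -LE.
Qed.

(** * Unit normals for both metrics *)

(** The Euclidean metric for s = 1 and the Lorentzian one for s = -1; both
    geometries are treated at once, with s ^+ 2 = 1. *)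
Definition flat_metric {R : realType} (s : R) (u v : 'rV[R]_3) : R :=
  u 0 0 * v 0 0 + u 0 1 * v 0 1 + s * (u 0 2 * v 0 2).

(** The vector that represents the linear form <u, _> for the metric with
    parameter s. *)
Definition sharp {R : realType} (s : R) (u : 'rV[R]_3) : 'rV[R]_3 :=
  \row_i (if i == 2 then s * u 0 i else u 0 i).

(** The unit normal of a surface with conormal u. The sign sigma, which is the one
    of the third coordinate of u, is a separate parameter: being locally constant,
    it need not be differentiated. *)
Definition normalize {R : realType} (s sigma : R) (u : 'rV[R]_3) : 'rV[R]_3 :=
  (sigma * s / Num.sqrt (s * flat_metric s u u)) *: sharp s u.

Lemma lorentzE {R : realType} : @lorentz R = flat_metric (-1).
Proof. by apply/funext => u; apply/funext => v; rewrite /lorentz /flat_metric mulN1r. Qed.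

Lemma euclidE {R : realType} : @euclid R = flat_metric 1.
Proof. by apply/funext => u; apply/funext => v; rewrite /euclid /flat_metric mul1r. Qed.

(** A normal vector is a multiple of sharp s n; the norm gives the square of the
    factor and the upward direction its sign. *)
Lemma upward_unit_normalE {R : realType} (s : R) (S : set 'rV[R]_3)
    (x n : 'rV[R]_3) :
  s ^+ 2 = 1 -> (forall v, tangent S x v <-> euclid n v = 0) -> n 0 2 != 0 ->
  0 < s * flat_metric s n n ->
  upward_unit_normal (flat_metric s) s S x = normalize s (Num.sg (n 0 2)) n.
Proof.
move=> s2 TE n2 D0; have s0 : s != 0.
  by apply/eqP => s0; move/eqP: s2; rewrite s0 expr0n/= eq_sym oner_eq0.
have sE := sqr_eq1 s2.
set D := s * _ in D0 *; set r := Num.sqrt D.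
have r0 : 0 < r by rewrite sqrtr_gt0.
have r2 : r ^+ 2 = D by rewrite sqr_sqrtr// ltW.
have sg2 : Num.sg (n 0 2) ^+ 2 = 1 by rewrite sqr_sg n2.
have sgn : Num.sg (n 0 2) * n 0 2 = `|n 0 2| by rewrite -normrEsg.
apply: get_unique.
  split.
  - move=> v /TE nv; rewrite /flat_metric !mxE/= -/D -/r.
    rewrite -[RHS](mulr0 (Num.sg (n 0 2) * s / r)) -[in RHS]nv /euclid.
    by case: sE => ->; ring.
  - transitivity (Num.sg (n 0 2) ^+ 2 * s ^+ 2 / r ^+ 2 * flat_metric s n n).
      rewrite /flat_metric !mxE/= -/D -/r.
      by case: sE => ->; field; exact: lt0r_neq0.
    rewrite sg2 s2 r2 mul1r mul1r /D invfM -mulrA mulVf ?mulr1; last first.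
      by apply/eqP => Q0; rewrite /D Q0 mulr0 ltxx in D0.
    by apply: (mulfI s0); rewrite divff// -expr2 s2.
  - rewrite !mxE/= -/D -/r.
    have -> : Num.sg (n 0 2) * s / r * (s * n 0 2) = s ^+ 2 * `|n 0 2| / r.
      by rewrite -sgn; ring.
    by rewrite s2 mul1r divr_gt0// normr_gt0.
move=> m [Tm mm m2].
have prop i j : sharp s m 0 i * n 0 j = sharp s m 0 j * n 0 i.
  apply: proportional_of_orthogonal => v nv.
  have <- : flat_metric s m v = euclid (sharp s m) v.
    by rewrite /flat_metric /euclid !mxE/= mulrA.
  by apply: Tm; apply/TE.
pose k := s * m 0 2 / n 0 2.
have m_n i : sharp s m 0 i = k * n 0 i.
  apply: (mulIf n2); rewrite prop !mxE/= /k; field; exact: n2.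
have mE : m = k *: sharp s n.
  apply: row3P.
  - by have := m_n 0; rewrite !mxE.
  - by have := m_n 1; rewrite !mxE.
  - by rewrite !mxE/= /k; case: sE => ->; field; exact: n2.
have k2 : (k * r) ^+ 2 = 1.
  rewrite exprMn r2 /D; transitivity (s * flat_metric s m m); last by rewrite mm -expr2.
  by rewrite mE /flat_metric !mxE/=; case: sE => ->; ring.
have kE : k = Num.sg (n 0 2) * s / r.
  have m2E : Num.sg (n 0 2) * s * k = m 0 2 / `|n 0 2|.
    have -> : `|n 0 2|^-1 = Num.sg (n 0 2) / n 0 2.
      have nn : `|n 0 2| != 0 by rewrite normr_eq0.
      apply: (mulIf n2); rewrite -mulrA mulVf// mulr1.
      by apply: (mulfI nn); rewrite mulrA divff// mul1r -sgn mulrAC -expr2 sg2 mul1r.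
    rewrite /k; transitivity (s ^+ 2 * (m 0 2 * (Num.sg (n 0 2) / n 0 2))).
      by ring.
    by rewrite s2 mul1r.
  have pos : 0 < Num.sg (n 0 2) * s * k * r.
    by rewrite m2E mulr_gt0// divr_gt0// normr_gt0.
  have : (Num.sg (n 0 2) * s * k * r) ^+ 2 = 1.
    rewrite -[_ * k * r]mulrA exprMn k2 mulr1 exprMn sg2 s2 mulr1//.
  move/eqP; rewrite sqrf_eq1 => /orP[/eqP E1|/eqP E1]; last first.
    by move: pos; rewrite E1 oppr_gt0 ltr10.
  rewrite -[LHS]mulr1 -[in LHS](divff (lt0r_neq0 r0)) mulrA; congr (_ / _).
  rewrite -[LHS]mul1r -sg2 -[LHS]mulr1 -s2.
  transitivity (Num.sg (n 0 2) * s * (Num.sg (n 0 2) * s * k * r)); first by ring.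
  by rewrite E1 mulr1.
by rewrite mE kE.
Qed.

Lemma inv_sqrt_is_diff {R : realType} (r : R) : 0 < r ->
  is_diff r (fun r : R => (Num.sqrt r)^-1) (fun y => - (y / (2 * r * Num.sqrt r))).
Proof.
move=> r0; have s0 : Num.sqrt r != 0 by rewrite gt_eqF// sqrtr_gt0.
have ds := is_derive1_sqrt r0.
have dh : derivable (fun r : R => (Num.sqrt r)^-1) r 1.
  exact: derivableV s0 (@ex_derive _ _ _ _ _ _ _ ds).
have dh' : differentiable (fun r : R => (Num.sqrt r)^-1) r.
  exact/derivable1_diffP.
apply: DiffDef => //; rewrite diff1E//; apply/funext => y.
rewrite derive1E (deriveV s0 (@ex_derive _ _ _ _ _ _ _ ds)).
rewrite (@derive_val _ _ _ _ _ _ _ ds) /GRing.scale/= sqr_sqrtr ?ltW//.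
by field; rewrite s0 gt_eqF.
Qed.

Lemma flat_metric_is_diff {R : realType} (s : R) (u : 'rV[R]_3) :
  is_diff u (fun u => s * flat_metric s u u) (fun w => 2 * (s * flat_metric s u w)).
Proof.
have c i := diff_coord i u.
have cc i := is_diffM (c i) (c i).
apply: is_diff_eq (is_diffZ s (is_diffD (is_diffD (cc 0) (cc 1)) (is_diffZ s (cc 2)))) _.
apply/funext => w; rewrite !fctE /GRing.scale/= /flat_metric; ring.
Qed.

Lemma sharp_is_diff {R : realType} (s : R) (u : 'rV[R]_3) (i : 'I_3) :
  is_diff u (fun u => sharp s u 0 i) (fun w => sharp s w 0 i).
Proof.
have c := diff_coord i u.
have [i2|i2] := boolP (i == 2).
  have -> : (fun u => sharp s u 0 i) = s *: (fun u : 'rV[R]_3 => u 0 i).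
    by apply/funext => w; rewrite mxE i2.
  exact: is_diffZ.
have -> : (fun u => sharp s u 0 i) = (fun u : 'rV[R]_3 => u 0 i).
  by apply/funext => w; rewrite mxE (negPf i2).
exact: c.
Qed.

Lemma normalize_diff {R : realType} (s sigma : R) (u w : 'rV[R]_3) :
  0 < s * flat_metric s u u ->
  differentiable (normalize s sigma) u /\
  'd (normalize s sigma) u w = (sigma * s / Num.sqrt (s * flat_metric s u u)) *:
    (sharp s w - (s * flat_metric s u w / (s * flat_metric s u u)) *: sharp s u).
Proof.
move=> D0.
have dk := is_diff_comp (flat_metric_is_diff s u) (inv_sqrt_is_diff D0).
have dN i := is_diffZ (sigma * s) (is_diffM dk (sharp_is_diff s u i)).
have NE i : (sigma * s) *: ((((fun r : R => (Num.sqrt r)^-1) \o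
      (fun u => s * flat_metric s u u)) : 'rV[R]_3 -> R) *
      (fun u : 'rV[R]_3 => sharp s u 0 i)) =
    (fun u => normalize s sigma u 0 i).
  by apply/funext => y; rewrite !fctE /normalize !mxE /GRing.scale/=; ring.
have dc i := @ex_diff _ _ _ _ _ _ _ (dN i).
have dnorm : differentiable (normalize s sigma) u.
  by apply: differentiable_row => i; rewrite -NE; exact: dc.
split=> //; apply/rowP => i.
have -> : 'd (normalize s sigma) u w 0 i =
    'd ((fun v : 'rV[R]_3 => v 0 i) \o normalize s sigma) u w.
  rewrite diff_comp//; last exact: differentiable_coord.
  by rewrite /= (@diff_val _ _ _ _ _ _ _ (diff_coord i _)).
have -> : (fun v : 'rV[R]_3 => v 0 i) \o normalize s sigma =
  (fun u => normalize s sigma u 0 i) by [].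
rewrite -NE (@diff_val _ _ _ _ _ _ _ (dN i)).
have r0 : Num.sqrt (s * flat_metric s u u) != 0 by rewrite gt_eqF// sqrtr_gt0.
rewrite !fctE /GRing.scale/= /comp/= !mxE.
set D := s * flat_metric s u u; set F := s * flat_metric s u w; set r := Num.sqrt D.
field.
by rewrite r0 (lt0r_neq0 D0).
Qed.

(** The derivative of a field of constant square norm is orthogonal to it; stated
    through the conormal, this says that the derivative is tangent. *)
Lemma normalize_diff_tangent {R : realType} (s sigma : R) (n w : 'rV[R]_3) :
  s ^+ 2 = 1 -> 0 < s * flat_metric s n n ->
  euclid n ('d (normalize s sigma) n w) = 0.
Proof.
move=> s2 D0; have [_ ->] := normalize_diff sigma w D0.
have sE := sqr_eq1 s2.
have s0 : s != 0 by case: sE => ->; rewrite ?oppr_eq0 oner_eq0.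
have Q0 : flat_metric s n n != 0.
  by apply/eqP => Q0; rewrite Q0 mulr0 ltxx in D0.
set k := sigma * s / _; set q := s * flat_metric s n w / _.
transitivity (k * (flat_metric s n w - q * flat_metric s n n)).
  rewrite /euclid !mxE/= /flat_metric.
  by clearbody q k; case: sE => ->; ring.
rewrite /q; have -> : s * flat_metric s n w / (s * flat_metric s n n) *
    flat_metric s n n = flat_metric s n w by field; rewrite s0 Q0.
by rewrite subrr mulr0.
Qed.

(** * Mean curvature as a divergence *)

(** Otherwise the tangent vector of steepest slope would not be spacelike, or
    would vanish together with the conormal. *)
Lemma spacelike_conormal {R : realType} (S U W : set 'rV[R]_3) (x : 'rV[R]_3)
    (phi psi : 'rV[R]_3 -> 'rV[R]_3) (n := conormal phi x) :
  spacelike S -> chart_at plane S x U W phi psi -> S x ->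
  n 0 0 ^+ 2 + n 0 1 ^+ 2 < n 0 2 ^+ 2.
Proof.
move=> spS ch Sx; rewrite ltNge; apply/negP => le.
pose m := n 0 0 ^+ 2 + n 0 1 ^+ 2.
pose v : 'rV[R]_3 := \row_i (if i == 2 then m else - n 0 2 * n 0 i).
have v0 : v 0 0 = - n 0 2 * n 0 0 by rewrite mxE.
have v1 : v 0 1 = - n 0 2 * n 0 1 by rewrite mxE.
have v2 : v 0 2 = m by rewrite mxE.
have Tv : tangent S x v.
  by apply/(tangent_conormal _ ch Sx); rewrite -/n /euclid v0 v1 v2 /m; ring.
have vneq0 : v != 0.
  apply/eqP => vz; have m0 : m = 0 by rewrite -v2 vz mxE.
  have /eqP := m0; rewrite paddr_eq0 ?sqr_ge0// !sqrf_eq0 => /andP[/eqP n0 /eqP n1].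
  have n2 : n 0 2 = 0.
    by apply/eqP; rewrite -sqrf_eq0 eq_le sqr_ge0 andbT; move: le; rewrite -/m m0.
  move: (conormal_neq0 ch); rewrite -/n => /eqP; apply.
  by apply: row3P; rewrite [RHS]mxE.
have := spS x v Sx Tv vneq0.
have -> : lorentz v v = m * (n 0 2 ^+ 2 - m).
  by rewrite /lorentz v0 v1 v2 /m; ring.
by rewrite ltNge mulr_ge0_le0// ?subr_le0// addr_ge0 ?sqr_ge0.
Qed.

Lemma sg_locally_constant {R : realType} {V : topologicalType} (f : V -> R)
    (x : V) (l : R) : f @ x --> l -> l != 0 ->
  \forall y \near x, Num.sg (f y) = Num.sg l.
Proof.
move=> fl; rewrite neq_lt => /orP[l0|l0]; near=> y.
  by rewrite !ltr0_sg//; near: y; exact: cvgr_lt fl _ l0.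
by rewrite !gtr0_sg//; near: y; exact: cvgr_gt fl _ l0.
Unshelve. all: by end_near. Qed.

(** The normalised conormal extends the unit normal to a neighbourhood of x, and
    the trace of its derivative over the tangent plane is the full trace, that is
    the divergence, because the derivative is tangent-valued. *)
Lemma mean_curvature_trace {R : realType} (s : R) (S U W : set 'rV[R]_3)
    (x : 'rV[R]_3) (phi psi : 'rV[R]_3 -> 'rV[R]_3)
    (n := conormal phi x) :
  s ^+ 2 = 1 -> chart_at plane S x U W phi psi -> S x ->
  (forall y, S y -> U y -> conormal phi y 0 2 != 0 /\
     0 < s * flat_metric s (conormal phi y) (conormal phi y)) ->
  trace_on (tangent S x)
    (fun v => - nabla S (upward_unit_normal (flat_metric s) s S) x v) =
  - \tr (lin1_mx ('d (normalize s (Num.sg (n 0 2))) n \o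
                  'd (conormal phi) x)).
Proof.
move=> s2 ch Sx pos; have [[oU Ux] _ sphi _ _] := ch.
have [n2 D0] := pos x Sx Ux; rewrite -/n in n2 D0.
set sigma := Num.sg _; have [Z ZE] : exists Z, Z = normalize s sigma \o conormal phi by eexists.
have dn := conormal_differentiable sphi Ux.
have dN w := normalize_diff sigma w D0.
have dZ : differentiable Z x.
  by rewrite ZE; apply: differentiable_comp => //; have [] := dN 0.
have dZE v : 'd Z x v = 'd (normalize s sigma) n ('d (conormal phi) x v).
  by have [dN0 _] := dN 0; rewrite ZE [in LHS]diff_comp.
have n2_cont : (fun y => conormal phi y 0 2) @ x --> n 0 2.
  apply: differentiable_continuous.
  exact: (differentiable_comp dn (differentiable_coord _ 0 2)).
have sg_near : \forall y \near x, Num.sg (conormal phi y 0 2) = sigma.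
  exact: sg_locally_constant n2_cont n2.
have ZN : \forall y \near x, S y -> Z y = upward_unit_normal (flat_metric s) s S y.
  near=> y; move=> Sy.
  have Uy : U y by near: y; exact: open_nbhs_nbhs.
  have chy := chart_at_point ch Uy.
  have [yn2 yD0] := pos y Sy Uy.
  have Ty v := tangent_conormal v chy Sy.
  have sgy : Num.sg (conormal phi y 0 2) = sigma by near: y.
  by rewrite (upward_unit_normalE s2 Ty yn2 yD0) sgy ZE.
rewrite (@trace_on_tangent _ _ n _ (- lin1_mx ('d Z x))).
- rewrite linearN/=; congr (- \tr (lin1_mx _)).
  by apply/funext => v; exact: dZE.
- exact: conormal_neq0 ch.
- by move=> v; exact: tangent_conormal ch Sx.
- move=> v /(tangent_conormal _ ch Sx) nv.
  by rewrite mulmxN mul_rV_lin1 (nabla_extension ch Sx nv ZN dZ).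
- move=> v; rewrite mulmxN mul_rV_lin1/= dZE.
  have euclidN (u w : 'rV[R]_3) : euclid u (- w) = - euclid u w.
    by rewrite /euclid !mxE; ring.
  by rewrite euclidN normalize_diff_tangent// oppr0.
Unshelve. all: by end_near. Qed.

(** * Ellipticity of the equation *)

(** The two tangent vectors below are orthogonal for both metrics. The
    squares of their lengths are m and m * D, where m is the square of the length
    of the horizontal part of n and D = s * flat_metric s n n, so only the second
    length depends on the metric. *)
Definition horizontal_tangent {R : realType} (n : 'rV[R]_3) : 'rV[R]_3 :=
  n 0 0 *: delta_mx 0 1 - n 0 1 *: delta_mx 0 0.

Definition steepest_tangent {R : realType} (n : 'rV[R]_3) : 'rV[R]_3 :=
  (n 0 0 ^+ 2 + n 0 1 ^+ 2) *: delta_mx 0 2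
  - n 0 2 *: (n 0 0 *: delta_mx 0 0 + n 0 1 *: delta_mx 0 1).

(** With dn the derivative of the conormal, (v, w) |-> euclid (dn v) w is the
    unnormalised second fundamental form. Its trace for the metric is computed in
    the basis v1, v2, in which the metric is diagonal. *)
Lemma normalize_trace {R : realType} (s sigma : R) (n : 'rV[R]_3)
    (dn : {linear 'rV[R]_3 -> 'rV[R]_3})
    (v1 := horizontal_tangent n) (v2 := steepest_tangent n)
    (m := n 0 0 ^+ 2 + n 0 1 ^+ 2) (D := s * flat_metric s n n) :
  s ^+ 2 = 1 -> m != 0 -> 0 < D ->
  \tr (lin1_mx ('d (normalize s sigma) n \o dn)) =
  sigma * s / (m * Num.sqrt D) * (euclid (dn v1) v1 + euclid (dn v2) v2 / D).
Proof.
move=> s2 m0 D0.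
have sE := sqr_eq1 s2.
have trE : \tr (lin1_mx ('d (normalize s sigma) n \o dn)) =
    \sum_i ('d (normalize s sigma) n (dn (delta_mx 0 i))) 0 i.
  by apply: eq_bigr => i _; rewrite mxE.
have dE w := (normalize_diff sigma w D0).2.
rewrite trE sum3E !dE -/D /v1 /v2 /horizontal_tangent /steepest_tangent.
rewrite !(linearB, linearD, linearZ)/=.
set a0 := dn (delta_mx 0 0); set a1 := dn (delta_mx 0 1).
set a2 := dn (delta_mx 0 2).
have r0 : Num.sqrt D != 0 by rewrite gt_eqF// sqrtr_gt0.
set r := Num.sqrt D in r0 *; clearbody r.
have Dneq0 := lt0r_neq0 D0.
rewrite /euclid !mxE/= /D /flat_metric in Dneq0 *.
clear trE dE D0 D v1 v2 s2; clearbody a0 a1 a2; rewrite /m in m0 *; clear m.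
case: sE Dneq0 => -> Dneq0; field; rewrite r0 m0 !andbT; move: Dneq0.
  by rewrite !mul1r.
by rewrite mulf_eq0 negb_or => /andP[_ ->].
Qed.

(** If a and b have the same sign, shrinking D from D1 to D2 strictly increases
    the absolute value of (a + b / D) / sqrt D. This is the ellipticity of the
    equation. *)
Lemma mean_curvature_balance {R : realType} (a b m sigma D1 D2 lambda : R) :
  0 < D2 -> D2 < D1 -> sigma != 0 -> m != 0 ->
  0 < lambda * a -> 0 < lambda * b ->
  - (sigma * 1 / (m * Num.sqrt D1) * (a + b / D1)) -
    sigma * -1 / (m * Num.sqrt D2) * (a + b / D2) != 0.
Proof.
move=> D20 D21 sigma0 m0 la lb.
have D10 := lt_trans D20 D21.
have r10 : 0 < Num.sqrt D1 by rewrite sqrtr_gt0.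
have r20 : 0 < Num.sqrt D2 by rewrite sqrtr_gt0.
have r21 : Num.sqrt D2 < Num.sqrt D1 by rewrite ltr_sqrt.
have lt : (lambda * a + lambda * b / D1) / Num.sqrt D1 <
          (lambda * a + lambda * b / D2) / Num.sqrt D2.
  apply: ltr_pM; rewrite ?invr_ge0 ?(ltW r10)//.
  - by rewrite addr_ge0 ?divr_ge0 ?ltW.
  - by rewrite ltrD2l ltr_pM2l// ltf_pV2.
  - by rewrite ltf_pV2.
apply/eqP => H.
have /eqP : sigma / m * ((lambda * a + lambda * b / D2) / Num.sqrt D2 -
    (lambda * a + lambda * b / D1) / Num.sqrt D1) = 0.
  rewrite -[RHS](mulr0 lambda) -[in RHS]H; field.
  by rewrite m0 (lt0r_neq0 D10) (lt0r_neq0 D20) (lt0r_neq0 r10) (lt0r_neq0 r20).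
rewrite mulf_eq0 mulf_eq0 invr_eq0 (negPf sigma0) (negPf m0)/= subr_eq0.
by rewrite gt_eqF.
Qed.

(** Where the tangent plane is not horizontal, the equality of the two mean
    curvatures forces the second fundamental form not to be definite. On a
    horizontal tangent plane the two metrics coincide, and the equality carries
    no information. *)
Lemma no_definite_curvature {R : realType} (S U W : set 'rV[R]_3)
    (x : 'rV[R]_3) (phi psi : 'rV[R]_3 -> 'rV[R]_3) (lambda : R) :
  spacelike S -> chart_at plane S x U W phi psi -> S x ->
  H_R S x = H_L S x ->
  (conormal phi x) 0 0 ^+ 2 + (conormal phi x) 0 1 ^+ 2 != 0 ->
  ~ (forall v, euclid (conormal phi x) v = 0 -> v != 0 ->
       0 < lambda * euclid ('d (conormal phi) x v) v).
Proof.
move=> spS ch Sx HRL m0.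
have sp y (Sy : S y) (Uy : U y) :
    conormal phi y 0 0 ^+ 2 + conormal phi y 0 1 ^+ 2 < conormal phi y 0 2 ^+ 2.
  exact: spacelike_conormal spS (chart_at_point ch Uy) Sy.
have pos (s : R) : s = 1 \/ s = -1 -> forall y, S y -> U y ->
    conormal phi y 0 2 != 0 /\
    0 < s * flat_metric s (conormal phi y) (conormal phi y).
  move=> sE y Sy Uy; have := sp y Sy Uy; move: (conormal phi y) => n lt.
  have ge0 : 0 <= n 0 0 ^+ 2 + n 0 1 ^+ 2 by rewrite addr_ge0 ?sqr_ge0.
  have n2 : 0 < n 0 2 ^+ 2 by exact: le_lt_trans lt.
  split; first by rewrite -sqrf_eq0 gt_eqF.
  rewrite /flat_metric -!expr2; case: sE => ->.
    by rewrite !mul1r ltr_wpDl.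
  by rewrite !mulN1r opprB subr_gt0.
have Ux : U x by case: ch => -[].
have s1 : (1 : R) ^+ 2 = 1 by rewrite expr1n.
have sN1 : (-1 : R) ^+ 2 = 1 by rewrite sqrrN expr1n.
have pos1 := pos 1 (or_introl (erefl _)).
have posN1 := pos (-1) (or_intror (erefl _)).
have T1 := mean_curvature_trace s1 ch Sx pos1.
have TN1 := mean_curvature_trace sN1 ch Sx posN1.
have [n2 D1] := pos1 x Sx Ux; have [_ DN1] := posN1 x Sx Ux.
rewrite (normalize_trace _ _ s1 m0 D1) in T1.
rewrite (normalize_trace _ _ sN1 m0 DN1) in TN1.
have H0 : trace_on (tangent S x)
      (fun v => - nabla S (upward_unit_normal (flat_metric 1) 1 S) x v) +
    trace_on (tangent S x)
      (fun v => - nabla S (upward_unit_normal (flat_metric (-1)) (-1) S) x v)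
    = 0.
  move: HRL; rewrite /H_R /H_L /A_R /A_L /N_R /N_L lorentzE euclidE.
  move=> /eqP; rewrite -subr_eq0 opprK -mulrDr mulf_eq0 invr_eq0 pnatr_eq0/=.
  by move/eqP.
rewrite {}T1 {}TN1 in H0.
move=> curv.

set n := conormal phi x in m0 n2 D1 DN1 H0 curv.
set v1 := horizontal_tangent n in H0; set v2 := steepest_tangent n in H0.
have v1E : [/\ v1 0 0 = - n 0 1, v1 0 1 = n 0 0 & v1 0 2 = 0].
  clearbody n; rewrite /v1 /horizontal_tangent; split; rewrite !mxE/=; ring.
have v2E : [/\ v2 0 0 = - n 0 2 * n 0 0, v2 0 1 = - n 0 2 * n 0 1 &
    v2 0 2 = n 0 0 ^+ 2 + n 0 1 ^+ 2].
  clearbody n; rewrite /v2 /steepest_tangent; split; rewrite !mxE/=; ring.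
have [v10 v11 v12] := v1E; have [v20 v21 v22] := v2E.
have nv1 : euclid n v1 = 0 by rewrite /euclid v10 v11 v12; ring.
have nv2 : euclid n v2 = 0 by rewrite /euclid v20 v21 v22; ring.
have v1neq0 : v1 != 0.
  apply: contraNneq m0 => v1z; move: v10 v11; rewrite v1z !mxE => /eqP.
  by rewrite eq_sym oppr_eq0 => /eqP -> <-; rewrite expr0n addr0.
have v2neq0 : v2 != 0.
  by apply: contraNneq m0 => v2z; rewrite -v22 v2z mxE.
have sg0 : Num.sg (n 0 2) != 0 by rewrite sgr_eq0.
have DD : -1 * flat_metric (-1) n n < 1 * flat_metric 1 n n.
  rewrite -subr_gt0.
  have -> : 1 * flat_metric 1 n n - -1 * flat_metric (-1) n n =
    2 * (n 0 0 ^+ 2 + n 0 1 ^+ 2) by rewrite /flat_metric; ring.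
  by rewrite mulr_gt0// lt_def m0 addr_ge0 ?sqr_ge0.
move/eqP: H0; apply/negP.
exact: mean_curvature_balance DN1 DD sg0 m0 (curv _ nv1 v1neq0)
  (curv _ nv2 v2neq0).
Qed.

(** * Touching from outside and the convex hull *)

(** At a maximum on the surface of a function with Hessian 2 eps, the gradient is
    a multiple lambda of the conormal, and the second derivative along a curve of
    the surface is not positive. This second derivative is computed from the
    field grad - lambda * conormal, which has the same scalar product with the
    velocity as grad and vanishes at q, so that the acceleration drops out. *)
Lemma touching_paraboloid {R : realType} (S U W : set 'rV[R]_3) (q a : 'rV[R]_3)
    (phi psi : 'rV[R]_3 -> 'rV[R]_3) (eps : R) :
  chart_at plane S q U W phi psi -> S q ->
  (forall x, S x -> euclid a x + eps * euclid x x <= euclid a q + eps * euclid q q) ->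
  exists lambda : R, a + (2 * eps) *: q = lambda *: conormal phi q /\
    forall v, euclid (conormal phi q) v = 0 ->
      2 * eps * euclid v v <= lambda * euclid ('d (conormal phi) q v) v.
Proof.
move=> ch Sq qmax; have [[oU Uq] _ sphi _ _] := ch.
pose grad (x : 'rV[R]_3) := a + (2 * eps) *: x.
have dk (c c' : R -> 'rV[R]_3) (t : R) : is_derive t 1 c (c' t) ->
    is_derive t 1 (fun t => euclid a (c t) + eps * euclid (c t) (c t))
      (euclid (grad (c t)) (c' t)).
  move=> dc.
  have da := is_derive_euclid (is_derive_cst a t 1) dc.
  have dq := is_deriveZ eps (is_derive_euclid dc dc).
  apply: is_derive_eq (is_deriveD da dq) _.
  by rewrite /grad /euclid /GRing.scale/= !mxE; ring.
have kmax (c c' : R -> 'rV[R]_3) : c 0 = q ->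
    (\forall t \near (0 : R), moves_on S U phi c c' t) ->
    \forall t \near (0 : R), euclid a (c t) + eps * euclid (c t) (c t) <=
      euclid a (c 0) + eps * euclid (c 0) (c 0).
  move=> c0 Hc; near=> t; rewrite c0; apply: qmax.
  by have [] : moves_on S U phi c c' t by near: t.
have crit v : euclid (conormal phi q) v = 0 -> euclid (grad q) v = 0.
  move=> nv; have [c [c' [c0 c'0 _ Hc]]] := chart_curve ch Sq nv.
  rewrite -c0 -c'0.
  apply: (local_max_derive (k' := fun t => euclid (grad (c t)) (c' t)) _ (kmax c c' c0 Hc)).
  near=> t; apply: dk.
  by have [] : moves_on S U phi c c' t by near: t.
have /rV0Pn[j nj] := conormal_neq0 ch.
pose lambda := grad q 0 j / conormal phi q 0 j.
have gradE : grad q = lambda *: conormal phi q.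
  apply/rowP => i; rewrite [RHS]mxE /lambda mulrAC.
  by rewrite (proportional_of_orthogonal crit j i) mulfK.
exists lambda; split=> // v nv.
have [c [c' [c0 c'0 dc' Hc]]] := chart_curve ch Sq nv.
pose G t := grad (c t) - lambda *: conormal phi (c t).
have G0 : G 0 = 0 by rewrite /G c0 gradE subrr.
have dG : is_derive (0 : R) 1 G
    ((2 * eps) *: v - lambda *: 'd (conormal phi) q v).
  have [_ _ dc _] := nbhs_singleton Hc.
  have dn : differentiable (conormal phi) (c 0).
    by rewrite c0; exact: conormal_differentiable sphi Uq.
  have dnc := is_derive_curve dc dn.
  have := is_deriveB (is_deriveD (is_derive_cst a (0 : R) 1)
    (is_deriveZ (2 * eps) dc)) (is_deriveZ lambda dnc).
  by rewrite add0r c'0 c0.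
have dGc := is_derive_euclid dG (derivableP dc').
rewrite G0 c'0 in dGc.
have : euclid ((2 * eps) *: v - lambda *: 'd (conormal phi) q v) v +
    euclid 0 ('D_1 c' 0) <= 0.
  apply: (local_max_derive2 _ (kmax c c' c0 Hc) dGc); near=> t.
  have [_ _ dct nct] : moves_on S U phi c c' t by near: t.
  apply: is_derive_eq (dk c c' t dct) _.
  rewrite -[LHS]subr0 -[in LHS](mulr0 lambda) -[in LHS]nct.
  by rewrite /G; move: (conormal phi (c t)) => nt; rewrite /euclid /grad !mxE; ring.
set A := 'd _ _ _ => ineq; rewrite -subr_le0; move: ineq.
by congr (_ <= _); rewrite /euclid !mxE; ring.
Unshelve. all: by end_near. Qed.

(** A chart onto the plane at one point is one at all points of its domain, so the
    interior is relatively open. *)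
Lemma surface_boundary_compact {R : realType} (S : set 'rV[R]_3) :
  compact S -> compact (surface_boundary S).
Proof.
move=> cS.
pose O := \bigcup_(U in [set U | exists x W phi psi,
  chart_at plane S x U W phi psi]) U.
have -> : surface_boundary S = S `&` ~` O.
  apply/seteqP; split=> x [Sx Hx]; split=> //.
    case=> U [y [W [phi [psi ch]]]] Ux; apply: Hx; split=> //.
    by exists U, W, phi, psi; exact: chart_at_point ch Ux.
  case=> _ [U [W [phi [psi ch]]]]; apply: Hx; exists U.
    by exists x, W, phi, psi.
  by case: ch => -[].
apply: compact_closedI => //; apply: open_closedC; apply: bigcup_open => U.
by case=> y [W [phi [psi [[]]]]].
Qed.

(** Strict separation survives small perturbations on a bounded set. This leaves
    room to tilt the functional until it is not vertical, and to add a strictly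
    convex term whose gradient, at most |b 0 0| / 2 horizontally, cannot make the
    total gradient vertical again. *)
Lemma separating_paraboloid {R : realType} (S K : set 'rV[R]_3)
    (p a : 'rV[R]_3) (delta : R) :
  compact S -> S p -> K `<=` S -> 0 < delta ->
  (forall k, K k -> delta <= euclid a (p - k)) ->
  exists (b : 'rV[R]_3) (eps : R), [/\ 0 < eps,
    forall k, K k -> euclid b k + eps * euclid k k < euclid b p + eps * euclid p p &
    forall q, S q -> (b + (2 * eps) *: q) 0 0 != 0].
Proof.
move=> cS Sp KS d0 sep.
have [C [C0 Csqr Cabs]] : exists C : R, [/\ 0 < C,
    forall x, S x -> euclid x x <= C & forall x, S x -> `|x 0 0| <= C].
  have [||c _ cmax] := @compact_EVT_max _ _ (fun x : 'rV[R]_3 => euclid x x) S _ cS.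
  - by exists p.
  - by apply: continuous_subspaceT; exact: euclid_sqr_continuous.
  have sqrC x : S x -> euclid x x <= 1 + euclid c c.
    by move=> Sx; rewrite ler_wpDl// cmax// inE.
  have C1 : 1 <= 1 + euclid c c by rewrite lerDl euclid_ge0.
  exists (1 + euclid c c); split=> // [|x Sx]; first exact: lt_le_trans C1.
  rewrite -ler_sqr ?nnegrE ?normr_ge0// ?(le_trans ler01)//.
  rewrite real_normK ?num_real//.
  apply: (@le_trans _ _ (1 + euclid c c)).
    apply: le_trans (sqrC x Sx); rewrite /euclid -!expr2 -addrA lerDl.
    by rewrite addr_ge0 ?sqr_ge0.
  by rewrite expr2 ler_peMl// (le_trans ler01).
have [b [b0 bsep]] : exists b : 'rV[R]_3, b 0 0 != 0 /\
    forall k, K k -> delta / 2 <= euclid b (p - k).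
  have [a0|a0] := eqVneq (a 0 0) 0; last first.
    exists a; split=> // k Kk; apply: le_trans (sep k Kk).
    by rewrite ler_pdivrMr// ler_peMr ?ltW// ltr1n.
  pose eta := delta / (4 * C).
  have eta0 : 0 < eta by rewrite divr_gt0// mulr_gt0.
  exists (a + eta *: delta_mx 0 0); split.
    by rewrite !mxE a0 add0r/= mulr1 gt_eqF.
  move=> k Kk.
  have -> : euclid (a + eta *: delta_mx 0 0) (p - k) =
      euclid a (p - k) + eta * (p 0 0 - k 0 0).
    by rewrite /euclid !mxE/=; ring.
  have pk : - (2 * C) <= p 0 0 - k 0 0.
    have := Cabs _ Sp; have := Cabs _ (KS _ Kk); rewrite !ler_norml.
    by move=> /andP[_ kC] /andP[pC _]; lra.
  have : eta * - (2 * C) <= eta * (p 0 0 - k 0 0) by rewrite ler_pM2l.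
  have -> : eta * - (2 * C) = - (delta / 2).
    by rewrite /eta; field; rewrite lt0r_neq0.
  by have := sep k Kk; lra.
pose mu := Num.min delta `|b 0 0|.
have mu0 : 0 < mu by rewrite lt_min d0 normr_gt0.
have mud : mu <= delta by rewrite ge_min lexx.
have mub : mu <= `|b 0 0| by rewrite ge_min lexx orbT.
pose eps := mu / (4 * C).
have eps0 : 0 < eps by rewrite divr_gt0// mulr_gt0.
have epsC : eps * C = mu / 4 by rewrite /eps; field; rewrite lt0r_neq0.
exists b, eps; split=> // [k Kk|q Sq].
  have pk : euclid b (p - k) = euclid b p - euclid b k.
    by rewrite /euclid !mxE; ring.
  have : eps * euclid k k <= eps * C by rewrite ler_pM2l// Csqr//; exact: KS.
  have : 0 <= eps * euclid p p by rewrite mulr_ge0 ?euclid_ge0 ?ltW.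
  by have := bsep k Kk; rewrite pk epsC; lra.
rewrite !mxE; apply/eqP => bq.
have : `|b 0 0| <= 2 * (eps * C).
  have -> : b 0 0 = - (2 * eps * q 0 0) by apply/eqP; rewrite -addr_eq0 bq.
  have eps2 : 0 < 2 * eps by rewrite mulr_gt0.
  by rewrite normrN normrM (gtr0_norm eps2) mulrA ler_pM2l// Cabs.
by rewrite epsC; lra.
Qed.

Theorem theorem5 (R : realType) (Sigma : set 'rV[R]_3)
  (Sigma_smooth : smooth_surface Sigma)
  (Sigma_connected : connected Sigma)
  (Sigma_spacelike : spacelike Sigma)
  (Sigma_compact : compact Sigma)
  (Sigma_boundary : surface_boundary Sigma !=set0)
  (Sigma_mean : forall p, Sigma p -> H_R Sigma p = H_L Sigma p) :
  Sigma `<=` convex_hull (surface_boundary Sigma).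
Proof.
move=> p Sp; apply: contrapT => hull_p.
have Kc := surface_boundary_compact Sigma_compact.
have [a [delta [d0 sep]]] := strict_separation Kc Sigma_boundary hull_p.
have KS : surface_boundary Sigma `<=` Sigma by move=> x [].
have [b [eps [eps0 below slope]]] :=
  separating_paraboloid Sigma_compact Sp KS d0 sep.
pose f (x : 'rV[R]_3) := euclid b x + eps * euclid x x.
have fc : continuous f.
  move=> x; exact: cvgD (@euclid_continuous R b x)
    (cvgM (cvg_cst eps) (@euclid_sqr_continuous R x)).
have [||q Sq qmax] := @compact_EVT_max _ _ f Sigma _ Sigma_compact.
- by exists p.
- exact: continuous_subspaceT.
have {}qmax x : Sigma x -> f x <= f q by move=> Sx; apply: qmax; rewrite inE.
rewrite inE in Sq.
have [_ [U [W [phi [psi ch]]]]] : surface_interior Sigma q.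
  apply: contrapT => qint; have /below : surface_boundary Sigma q by [].
  by rewrite ltNge => /negP; apply; exact: qmax.
have [lambda [grad curv]] := touching_paraboloid ch Sq qmax.
apply: (no_definite_curvature (lambda := lambda) Sigma_spacelike ch Sq (Sigma_mean q Sq)).
  apply: contra (slope q Sq) => /eqP m0.
  have n0 : conormal phi q 0 0 = 0.
    apply/eqP; rewrite -sqrf_eq0.
    by move/eqP: m0; rewrite paddr_eq0 ?sqr_ge0// => /andP[].
  by rewrite grad mxE n0 mulr0.
move=> v nv v0; apply: lt_le_trans (curv v nv).
rewrite !mulr_gt0// lt_def euclid_ge0 andbT.
by apply: contra v0 => /eqP/euclid_eq0 ->.
Qed.
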